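(* For every $\varepsilon>0$ there exists $c>0$ such that if $p=p(n)\ge(1+\varepsilon)\log n/n$, then $G\sim G(n,p)$ admits, with probability tending to $1$ as $n\to\infty$, a strong $d$-rigid partition for $d=cnp/\log(np)$.
   Context: $G(n,p)$ is the binomial random graph on $[n]$ in which each pair is an edge independently with probability $p$. For $A,B\subseteq V$, $G[A,B]$ is the graph on $A\cup B$ with the edges of $G$ having one endpoint in $A$ and the other in $B$. A strong $d$-rigid partition of $G$ is a partition $V=V_1\cup\dots\cup V_d$ into nonempty sets such that $G[V_i,V_j]$ is connected for all $1\le i\le j\le d$. Logarithms are natural; the paper omits floor and ceiling signs, so $d$ is to be understood as rounded to an integer. *)

(* Defs.v *)
From HB Require Import structures.
From mathcomp Require Import all_boot all_order all_algebra.
From mathcomp Require Import all_classical all_reals all_analysis.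

Set Implicit Arguments.
Unset Strict Implicit.
Unset Printing Implicit Defensive.

Import Order.TTheory GRing.Theory Num.Theory.
Import numFieldNormedType.Exports.

Local Open Scope ring_scope.

Section Graphs.
Variable T : finType.

Definition vertex_pairs : {set {set T}} := [set e : {set T} | #|e| == 2%N].

(* A simple graph on T is given by its edge set E \subset vertex_pairs. *)
Implicit Types (E P : {set {set T}}) (S A B : {set T}).

Definition adj E : rel T := fun x y => [set x; y] \in E.

(* The edge set of G[A, B], whose vertex set is A :|: B. For A = B this is the
   induced subgraph G[A]. *)
Definition edges_between E A B : {set {set T}} :=
  [set e in E | [exists a in A, exists b in B, e == [set a; b]]].

(* Connectedness of the graph with vertex set S and edge set E; meant for
   edges of E that lie inside S. *)
Definition connected_graph S E : bool :=
  [forall x in S, forall y in S, connect (adj E) x y].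

(* G[A, B] and G[B, A] coincide, so ranging over all A, B in P (A = B included)
   amounts to ranging over i <= j for an enumeration V_1, ..., V_d of P.
   Nonemptiness of the parts is a component of [finset.partition]. *)
Definition strong_rigid_partition (d : nat) E P : bool :=
  [&& finset.partition P [set: T], #|P| == d &
      [forall A in P, forall B in P,
         connected_graph (A :|: B) (edges_between E A B)]].

Definition has_strong_rigid_partition (d : nat) E : bool :=
  [exists P : {set {set T}}, strong_rigid_partition d E P].

End Graphs.

(* The probability that G(n, p) has the property Q: each pair is an edge with
   probability p, independently of the others. *)
Definition gnp_prob (R : realType) (n : nat) (p : R)
    (Q : {set {set 'I_n}} -> bool) : R :=
  \sum_(E : {set {set 'I_n}} | (E \subset vertex_pairs 'I_n) && Q E)
    \prod_(e in vertex_pairs 'I_n) (if e \in E then p else 1 - p).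

(* Main.v *)
Require Import Defs.
From HB Require Import structures.
From mathcomp Require Import all_boot all_order all_algebra.
From mathcomp Require Import all_classical all_reals all_analysis.
From mathcomp Require Import ring lra zify.

Set Implicit Arguments.
Unset Strict Implicit.
Unset Printing Implicit Defensive.

Import Order.TTheory GRing.Theory Num.Theory.
Import numFieldNormedType.Exports.

Local Open Scope ring_scope.

(* Write X = n p, L = ln X. With high probability G(n, p) satisfies:
   (i) all degrees lie between a X and 6 X, where a depends on eps only;
   (ii) for h ~ 6 e^3 L and m ~ 5 L / p, no nonempty set of fewer than 2m
   vertices induces minimum degree at least 2h;
   (iii) there is an edge between any two disjoint sets of m vertices.
   Given (i), a uniformly random colouring of the vertices with d = c X / L
   colours leaves a given vertex with fewer than 2h neighbours in some colour
   class with probability at most X^-3, while this event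
   depends on at most (6 X)^2 others, so by the Lovasz local lemma some
   colouring gives every vertex at least 2h neighbours in every class.
   Its classes form a strong rigid partition: if a closed proper part Z of
   G[V_i, V_j] is split off from its complement Z', then Z, Z', V_i and V_j all
   have minimum degree at least 2h, hence at least 2m vertices by (ii), so two
   opposite pieces of Z and Z' have at least m vertices each and (iii) gives an
   edge between them. *)

(** * The Lovasz local lemma *)

Lemma card_bigcup_le (R : realType) (I J : finType) (S : {set I})
    (A : I -> {set J}) (b : R) :
  (forall i, i \in S -> #|A i|%:R <= b) ->
  #|\bigcup_(i in S) A i|%:R <= #|S|%:R * b.
Proof.
move=> h; rewrite mulr_natl -[b *+ _]sumr_const.
apply: (big_ind2 (fun (U : {set J}) (x : R) => #|U|%:R <= x)) => //.
- by rewrite cards0.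
- move=> U x V y hU hV; apply: le_trans (lerD hU hV).
  by rewrite -natrD ler_nat leq_card_setU.
Qed.

Section LovaszLocalLemma.
Variables (R : realType) (T C : finType).
Local Notation Omega := {ffun T -> C}.
Implicit Types (A B : {set Omega}) (N : {set T}).

Definition depends_on N A :=
  forall f g : Omega, {in N, f =1 g} -> (f \in A) = (g \in A).

(* Swapping the coordinates in N of two colourings f and g is an involution
   that maps (A :&: B) * Omega onto A * B. *)
Lemma card_setI_independent N A B :
  depends_on N A -> depends_on (~: N) B ->
  (#|A :&: B| * #|[set: Omega]| = #|A| * #|B|)%N.
Proof.
move=> hA hB.
pose mix (f g : Omega) : Omega := [ffun x => if x \in N then f x else g x].
pose phi (u : Omega * Omega) := (mix u.1 u.2, mix u.2 u.1).
have phiK : involutive phi.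
  move=> [f g]; rewrite /phi /=.
  by congr pair; apply/ffunP => x; rewrite !ffunE /=; case: (x \in N).
rewrite -!cardsX -(card_preimset (finset.setX A B) (inv_inj phiK)).
apply: eq_card => -[f g]; rewrite !inE /= andbT; congr (_ && _).
  by apply: hA => x xN; rewrite ffunE xN.
by apply: hB => x; rewrite inE => /negbTE xN; rewrite ffunE xN.
Qed.

Variables (I : finType) (A : I -> {set Omega}) (N : I -> {set T}) (q D : R).
Hypothesis depA : forall i, depends_on (N i) (A i).
Hypothesis ubA : forall i, #|A i|%:R <= q * #|[set: Omega]|%:R.
Hypothesis ubD : forall i, #|[set j | ~~ [disjoint N i & N j]]|%:R <= D.
Hypothesis D_ge1 : 1 <= D.
Hypothesis qD : 4 * q * D <= 1.
Hypothesis Omega_gt0 : (0 < #|[set: Omega]|)%N.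

Let avoid (S : {set I}) := ~: \bigcup_(i in S) A i.

Lemma depends_avoid (S : {set I}) (M : {set T}) :
  (forall j, j \in S -> N j \subset M) -> depends_on M (avoid S).
Proof.
move=> h f g fg; rewrite !inE; congr (~~ _).
apply/bigcupP/bigcupP => -[j jS]; rewrite ?inE => jA; exists j => //.
  by rewrite -(depA (i := j) (f := f))// => x xN; apply: fg; apply: (fintype.subsetP (h j jS)).
by rewrite (depA (i := j) (g := g))// => x xN; apply: fg; apply: (fintype.subsetP (h j jS)).
Qed.

(** In counting form: given that the events of [S] are avoided, [A i] has probability at most
    [2 * q]. Strong induction on the size of [S], split into [S1], the events sharing a coordinate
    with [A i], and the rest [S2]. Independence bounds [A i] within [avoid S2], and passing from
    [avoid S2] to [avoid S] costs at most a factor 2, since the at most [D] events of [S1] remove a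
    fraction at most [2 * q * D <= 1/2]. *)
Lemma lovasz_local_step (S : {set I}) (i : I) :
  #|A i :&: avoid S|%:R <= 2 * q * #|avoid S|%:R :> R.
Proof.
have q_ge0 : 0 <= q.
  have := le_trans (ler0n _ _) (ubA i).
  by rewrite pmulr_lge0// ltr0n.
have [s] := ubnP #|S|; elim: s S i => // s IH S i Ss.
pose S1 := [set j in S | ~~ [disjoint N i & N j]].
pose S2 := [set j in S | [disjoint N i & N j]].
have S12 : S = S1 :|: S2.
  by apply/setP => j; rewrite !inE -andb_orr orNb andbT.
have avS2 : avoid S \subset avoid S2.
  rewrite finset.setCS; apply/bigcupsP => j; rewrite inE => /andP[jS _].
  exact: (finset.bigcup_sup j).
have le2 : #|A i :&: avoid S|%:R <= q * #|avoid S2|%:R :> R.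
  apply: (@le_trans _ _ #|A i :&: avoid S2|%:R).
    by rewrite ler_nat subset_leq_card// finset.setIS.
  (* Multiplying by the number of colourings brings independence into its division-free form. *)
  rewrite -(@ler_pM2r _ #|[set: Omega]|%:R) ?ltr0n// -natrM.
  rewrite (card_setI_independent (depA (i := i))); last first.
    apply: depends_avoid => j; rewrite inE => /andP[_]; rewrite disjoint_sym.
    by rewrite finset.disjoints_subset.
  by rewrite natrM mulrAC ler_wpM2r.
have half : #|avoid S2|%:R <= 2 * #|avoid S|%:R :> R.
  have S1D : #|S1|%:R <= D.
    apply: le_trans (ubD i); rewrite ler_nat subset_leq_card//.
    by apply/fintype.subsetP => j; rewrite !inE => /andP[].
  have cov : avoid S2 \subset avoid S :|: \bigcup_(j in S1) (A j :&: avoid S2).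
    apply/fintype.subsetP => f fS2; rewrite inE; case: (boolP (f \in avoid S)) => //=.
    rewrite inE negbK => /bigcupP[j jS fj]; apply/bigcupP; exists j; last first.
      by rewrite inE fj fS2.
    move: jS; rewrite S12 inE => /orP[//|jS2]; move: fS2; rewrite inE => /bigcupP[].
    by exists j.
  have bU : #|\bigcup_(j in S1) (A j :&: avoid S2)|%:R <=
      #|S1|%:R * (2 * q * #|avoid S2|%:R).
    apply: card_bigcup_le => j jS1; apply: IH.
    (* The index [j] lies in [S1], so [S2] is strictly smaller than [S] and the induction hypothesis
       applies. *)
    rewrite ltnS in Ss; apply: leq_trans Ss; apply: proper_card.
    apply/properP; split; first by rewrite S12 finset.subsetUr.
    exists j; first by rewrite S12 inE jS1.
    by move: jS1; rewrite !inE => /andP[_ /negbTE ->]; rewrite andbF.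
  have : #|avoid S2|%:R <= #|avoid S|%:R + #|S1|%:R * (2 * q * #|avoid S2|%:R).
    apply: le_trans (lerD (lexx _) bU); rewrite -natrD ler_nat.
    exact: leq_trans (subset_leq_card cov) (leq_card_setU _ _).
  have : #|S1|%:R * (2 * q * #|avoid S2|%:R) <= D * (2 * q * #|avoid S2|%:R).
    by rewrite ler_wpM2r// !mulr_ge0.
  have : 4 * q * D * #|avoid S2|%:R <= #|avoid S2|%:R by rewrite ler_piMl.
  lra.
by apply: (le_trans le2); rewrite -mulrA mulrCA ler_wpM2l.
Qed.

Lemma lovasz_local : exists f, forall i, f \notin A i.
Proof.
(* Events are added one at a time; by the previous lemma each leaves a fraction at least
   [1 - 2 * q > 0] of the colourings. *)
suff gt0 (s : seq I) : (0 < #|avoid [set i in s]|)%N.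
  have /card_gt0P[f] := gt0 (enum I); rewrite inE => /bigcupP fP; exists f => i.
  by apply/negP => fi; apply: fP; exists i => //; rewrite inE mem_enum.
elim: s => [|i s IH].
  rewrite (_ : [set i in [::]] = finset.set0); last by apply/setP => i; rewrite !inE.
  by rewrite /avoid finset.big_set0 finset.setC0.
rewrite -(ltr0n R) in IH; rewrite -(ltr0n R).
have step := lovasz_local_step [set i in s] i.
have q2 : 2 * q < 1.
  by have [q0|q0] := leP 0 q; [have := ler_wpM2l q0 D_ge1; move: qD; lra|lra].
have : #|avoid [set j in s]|%:R <=
   #|avoid [set j in i :: s]|%:R + #|A i :&: avoid [set j in s]|%:R :> R.
  rewrite -natrD ler_nat; apply: leq_trans (leq_card_setU _ _).
  apply/subset_leq_card/fintype.subsetP => f fs; rewrite inE.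
  case: (boolP (f \in A i)) => fi; first by rewrite finset.in_setI fi fs orbT.
  rewrite inE; apply/orP; left; apply/bigcupP => -[j]; rewrite !inE => /orP[/eqP->|js fj].
    by apply/negP.
  by move: fs; rewrite inE => /bigcupP[]; exists j; rewrite ?inE.
have q0 : 0 < 1 - 2 * q by lra.
have := mulr_gt0 q0 IH; nra.
Qed.

End LovaszLocalLemma.

(** * Random colourings with many neighbours in every class *)

Section Colouring.
Variables (R : realType) (T : finType) (d : nat).
Local Notation Omega := {ffun T -> 'I_d}.

(** A Chernoff bound by counting. If [c < k] members of [N] have colour [i], then
    [e^k * 2^-c >= (e/2)^c >= 1], so the indicator is at most [e^k * 2^-c]; the mean of [2^-c] is
    [(1 - 1/(2d))^#|N|]. *)
Lemma card_few_in_class (N : {set T}) (k : nat) (i : 'I_d) :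
  #|[set f : Omega | (#|[set u in N | f u == i]| < k)%N]|%:R <=
  expR (k%:R - #|N|%:R / (2 * d%:R)) * #|[set: Omega]|%:R :> R.
Proof.
have d0 : (0 < d)%N by case: d i => [[]|].
pose w (u : T) (j : 'I_d) : R := if (u \in N) && (j == i) then 2^-1 else 1.
have w_ge0 u j : 0 <= w u j by rewrite /w; case: ifP => // _; rewrite invr_ge0.
have wE (f : Omega) : \prod_u w u (f u) = 2^-1 ^+ #|[set u in N | f u == i]|.
  rewrite -prodr_const [RHS]big_mkcond; apply: eq_bigr => u _.
  by rewrite inE.
have e2 : 1 <= expR 1 / 2 :> R.
  by rewrite ler_pdivlMr// mul1r (le_trans _ (expR_ge1Dx _))//; lra.
apply: (@le_trans _ _ (\sum_(f : Omega) expR 1 ^+ k * \prod_u w u (f u))).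
  rewrite -sum1_card natr_sum [leLHS]big_mkcond; apply: ler_sum => f _.
  rewrite inE; case: ifPn => [fk|_]; last first.
    by rewrite mulr_ge0 ?exprn_ge0 ?expR_ge0// prodr_ge0.
  rewrite wE; set c := #|_| in fk *.
  apply: (@le_trans _ _ (expR 1 ^+ c * 2^-1 ^+ c)).
    by rewrite -exprMn exprn_ege1.
  rewrite ler_wpM2r ?exprn_ge0 ?invr_ge0// ler_weXn2l ?(ltnW fk)//.
  by rewrite -[leLHS]expR0 ler_expR.
(* The sum over colourings factorises over the vertices; each member of [N] contributes [d - 1/2],
   any other vertex [d]. *)
rewrite -mulr_sumr -(bigA_distr_bigA w).
have wsum u : \sum_j w u j = d%:R * (if u \in N then 1 - (2 * d%:R)^-1 else 1).
  rewrite /w; case: (u \in N) => /=; last by rewrite mulr1 sumr_const card_ord.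
  rewrite (bigD1 i)//= eqxx (eq_bigr (fun=> 1)); last by move=> j /negbTE ->.
  have := sumr_const 'I_d (1 : R); rewrite (bigD1 i)//= card_ord => h.
  have -> : \sum_(j < d | j != i) 1 = d%:R - 1 :> R by rewrite -h; ring.
  by field; rewrite pnatr_eq0 -lt0n.
under eq_bigr do rewrite wsum.
rewrite big_split/= prodr_const cardsT card_ffun card_ord natrX -big_mkcond prodr_const.
rewrite expRD -[k%:R]mul1r expRM_natr mulrA mulrAC ler_wpM2r ?exprn_ge0//.
rewrite ler_wpM2l ?exprn_ge0 ?expR_ge0//. rewrite [_ / _]mulrC -mulNr expRM_natr.
rewrite lerXn2r// ?nnegrE ?expR_ge0//; last by rewrite expR_ge1Dx.
have : (2 * d%:R)^-1 <= 1 :> R; last by lra.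
rewrite invf_le1 ?mulr_gt0 ?ltr0n//.
have : 1 <= d%:R :> R by rewrite ler1n.
lra.
Qed.

(** The local lemma is applied to the events that some class contains fewer than [k] members of
    [N v]. Such an event depends on the colours of [N v] only, and by symmetry any [w] with [N w]
    meeting [N v] lies in [N u] for some [u] in [N v], which leaves at most [Delta ^+ 2] choices. *)
Lemma exists_colouring (N : T -> {set T}) (k : nat) (a Delta : R) :
  (0 < d)%N -> 1 <= Delta ->
  (forall u v, (u \in N v) = (v \in N u)) ->
  (forall v, a <= #|N v|%:R <= Delta) ->
  4 * (d%:R * expR (k%:R - a / (2 * d%:R))) * Delta ^+ 2 <= 1 ->
  exists f : Omega, forall v i, (k <= #|[set u in N v | f u == i]|)%N.
Proof.
move=> d0 D1 Nsym Nb small.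
pose A v : {set Omega} :=
  \bigcup_(i in [set: 'I_d]) [set f : Omega | (#|[set u in N v | f u == i]| < k)%N].
have [||||||f fA] := @lovasz_local R T 'I_d T A N
   (d%:R * expR (k%:R - a / (2 * d%:R))) (Delta ^+ 2).
- move=> v f g fg; apply/bigcupP/bigcupP => -[i _]; rewrite inE => h; exists i => //;
  rewrite inE; apply: leq_trans h; rewrite ltnS; apply/subset_leq_card/fintype.subsetP => u;
  by rewrite !inE => /andP[uN]; rewrite uN fg.
- move=> v; rewrite -mulrA.
  pose b : R := expR (k%:R - a / (2 * d%:R)) * #|[set: Omega]|%:R.
  apply: le_trans (card_bigcup_le (b := b) _) _.
    move=> i _; apply: (le_trans (card_few_in_class _ _ _)).
    rewrite ler_wpM2r// ler_expR lerB// ler_wpM2r ?invr_ge0 ?mulr_ge0//.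
    by have /andP[] := Nb v.
  by rewrite cardsT card_ord.
- move=> v.
  have : [set w | ~~ [disjoint N v & N w]] \subset \bigcup_(u in N v) N u.
    apply/fintype.subsetP => w; rewrite inE -finset.setI_eq0 => /finset.set0Pn[u].
    rewrite inE => /andP[uv uw]; apply/bigcupP; exists u => //.
    by rewrite Nsym.
  move=> /subset_leq_card; rewrite -(ler_nat R) => /le_trans; apply.
  have h u : u \in N v -> #|N u|%:R <= Delta by have /andP[] := Nb u.
  apply: le_trans (card_bigcup_le h) _.
  by rewrite expr2 ler_wpM2r ?(le_trans ler01 D1)//; have /andP[] := Nb v.
- by rewrite expr_ge1// (le_trans ler01 D1).
- exact: small.
- by rewrite cardsT card_ffun card_ord expn_gt0 d0.
exists f => v i; rewrite leqNgt; apply/negP => h.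
by have /bigcupP[] := fA v; exists i => //; rewrite inE.
Qed.
End Colouring.

(** * From a colouring to a strong rigid partition *)

Section Deterministic.
Variable T : finType.
Implicit Types (E : {set {set T}}) (A B U X : {set T}).

Definition nbrs E (v : T) : {set T} := [set u | adj E v u].

Lemma adjC E x y : adj E x y = adj E y x.
Proof. by rewrite /adj finset.setUC. Qed.

Lemma strong_rigid_of_colouring (d : nat) E (f : T -> 'I_d) (k m : nat) :
  (0 < #|T|)%N -> (0 < k)%N ->
  (forall v i, (k <= #|[set u in nbrs E v | f u == i]|)%N) ->
  (forall U, U != finset.set0 -> (#|U| < m.*2)%N ->
     exists2 x, x \in U & (#|nbrs E x :&: U| < k)%N) ->
  (forall A B, [disjoint A & B] -> (m <= #|A|)%N -> (m <= #|B|)%N ->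
     exists a b, [/\ a \in A, b \in B & adj E a b]) ->
  has_strong_rigid_partition d E.
Proof.
move=> T0 k0 fk small large.
pose V (i : 'I_d) : {set T} := [set u | f u == i].
have nV v i : nbrs E v :&: V i = [set u in nbrs E v | f u == i].
  by apply/setP => u; rewrite !inE.
have [v0 _] : exists v0 : T, v0 \in T by apply/card_gt0P.
have Vex i : exists u, u \in V i.
  have /card_gt0P[u] := leq_trans k0 (fk v0 i).
  by rewrite !inE => /andP[_ ui]; exists u; rewrite inE.
(* Contrapositive of [small]: inner minimum degree [k] forces at least [2m] vertices. It is applied
   both to the classes and to the two sides of a disconnection. *)
have big X : X != finset.set0 -> (forall x, x \in X -> (k <= #|nbrs E x :&: X|)%N) ->
    (m.*2 <= #|X|)%N.
  move=> X0 hX; rewrite leqNgt; apply/negP => /(small X X0)[x xX].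
  by rewrite ltnNge hX.
have Vbig i : (m.*2 <= #|V i|)%N.
  apply: big => [|x _]; last by rewrite nV.
  by apply/finset.set0Pn.
have Vinj : injective V.
  move=> i j Vij; have [u ui] := Vex i.
  have := ui; rewrite Vij; move: ui; rewrite !inE => /eqP <- /eqP.
  by [].
apply/existsP; exists [set V i | i in 'I_d]; apply/and3P; split.
- apply/and3P; split.
  + apply/eqP/setP => u; rewrite finset.in_setT; apply/bigcupP; exists (V (f u)).
      exact: imset_f.
    by rewrite inE.
  + apply/finset.trivIsetP => _ _ /imsetP[i _ ->] /imsetP[j _ ->] ij.
    rewrite -finset.setI_eq0; apply/eqP/setP => u; rewrite !inE.
    by apply/negP => /andP[/eqP ui /eqP uj]; rewrite -ui -uj eqxx in ij.
  + by apply/imsetP => -[i _ /esym Vi]; have [u] := Vex i; rewrite Vi inE.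
- by rewrite card_imset// card_ord.
apply/forall_inP => _ /imsetP[i _ ->]; apply/forall_inP => _ /imsetP[j _ ->].
apply/forall_inP => x xW; apply/forall_inP => y yW; apply/negPn/negP => nxy.
set EE := edges_between E (V i) (V j) in nxy.
have EEi z u : z \in V i -> u \in V j -> adj E z u -> adj EE z u.
  move=> zi uj zu; rewrite /adj /EE /edges_between finset.in_set.
  apply/andP; split; first exact: zu.
  by apply/exists_inP; exists z => //; apply/exists_inP; exists u.
(* The component of [x] and its complement: no edge of [EE] joins [X] to [Y]. *)
pose X := [set z in V i :|: V j | connect (adj EE) x z].
pose Y := [set z in V i :|: V j | ~~ connect (adj EE) x z].
have XYc z : z \in V i :|: V j -> (z \in Y) = (z \notin X).
  by move=> zW; rewrite !finset.in_set in zW *; rewrite zW.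
have clX z u : z \in X -> u \in V i :|: V j -> adj EE z u -> u \in X.
  rewrite !finset.in_set => /andP[_ xz] -> zu /=.
  by apply: (connect_trans xz); apply: connect1.
(* A vertex of [V i] has [k] neighbours in [V j] and vice versa; these edges lie in [EE], so
   closedness keeps the neighbours in the same side. *)
have bigC Z : (Z == X) || (Z == Y) -> Z != finset.set0 -> (m.*2 <= #|Z|)%N.
  move=> ZXY Z0; apply: big => // z zZ.
  have zW : z \in V i :|: V j.
    by case/orP: ZXY zZ => /eqP ->; rewrite finset.in_set => /andP[].
  have clZ u : u \in V i :|: V j -> adj EE z u -> u \in Z.
    move=> uW zu; case/orP: ZXY zZ => /eqP -> zZ; first exact: clX zZ uW zu.
    rewrite XYc//; apply/negP => uX; move: zZ; rewrite XYc// => /negP; apply.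
    by apply: clX uX zW _; rewrite adjC.
  case/setUP: (zW) => zV.
    apply: leq_trans (fk z j) _; rewrite -nV; apply/subset_leq_card/fintype.subsetP => u.
    rewrite !finset.in_setI => /andP[zu uj]; rewrite zu clZ//.
      by rewrite finset.in_setU uj orbT.
    by apply: EEi => //; rewrite inE in zu.
  apply: leq_trans (fk z i) _; rewrite -nV; apply/subset_leq_card/fintype.subsetP => u.
  rewrite !finset.in_setI => /andP[zu ui]; rewrite zu clZ//.
    by rewrite finset.in_setU ui.
  by rewrite adjC; apply: EEi => //; rewrite adjC; rewrite inE in zu.
have X0 : X != finset.set0.
  by apply/finset.set0Pn; exists x; rewrite finset.in_set xW connect0.
have Y0 : Y != finset.set0.
  by apply/finset.set0Pn; exists y; rewrite finset.in_set yW.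
have := bigC X; rewrite eqxx => /(_ isT X0) Xbig.
have := bigC Y; rewrite eqxx orbT => /(_ isT Y0) Ybig.
have split2 A B (Z : {set T}) : Z \subset A :|: B -> (#|Z| <= #|Z :&: A| + #|Z :&: B|)%N.
  move=> ZAB; rewrite -{1}(finset.setIidPl ZAB) finset.setIUr.
  exact: leq_card_setU.
have Wsub (P : pred T) : [set z in V i :|: V j | P z] \subset V i :|: V j.
  by apply/fintype.subsetP => z; rewrite finset.in_set => /andP[].
have splitV (l : 'I_d) : V l \subset V i :|: V j -> (m.*2 <= #|X :&: V l| + #|Y :&: V l|)%N.
  move=> lW; apply: leq_trans (Vbig l) _; rewrite ![_ :&: V l]finset.setIC.
  apply: split2; apply/fintype.subsetP => z /(fintype.subsetP lW) zW.
  by rewrite finset.in_setU XYc// orbN.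
have noedge a b (l l' : 'I_d) : a \in X :&: V l -> b \in Y :&: V l' ->
    (l = i /\ l' = j) \/ (l = j /\ l' = i) -> adj E a b -> False.
  rewrite !finset.in_setI => /andP[aX al] /andP[bY bl'] ll ab.
  have bW : b \in V i :|: V j by move: bY; rewrite finset.in_set => /andP[].
  move: bY; rewrite XYc// => /negP; apply; apply: clX aX bW _.
  case: ll => -[li lj]; rewrite li lj in al bl'; first exact: EEi.
  by rewrite adjC; apply: EEi => //; rewrite adjC.
have disXY (l l' : 'I_d) : [disjoint X :&: V l & Y :&: V l'].
  rewrite -finset.setI_eq0; apply/eqP/setP => z; rewrite !finset.in_set.
  by case: connect; rewrite ?andbF.
have contra (l l' : 'I_d) : (l = i /\ l' = j) \/ (l = j /\ l' = i) ->
    (m <= #|X :&: V l|)%N -> (m <= #|Y :&: V l'|)%N -> False.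
  move=> ll mX mY; have [a [b [aX bY ab]]] := large _ _ (disXY l l') mX mY.
  exact: noedge aX bY ll ab.
have sX := split2 _ _ X (Wsub _); have sY := split2 _ _ Y (Wsub _).
have si := splitV i (finset.subsetUl _ _); have sj := splitV j (finset.subsetUr _ _).
have c1 := contra i j (or_introl (conj erefl erefl)).
have c2 := contra j i (or_intror (conj erefl erefl)).
(* Each of [X], [Y], [V i], [V j] has at least [2m] vertices, so a piece below [m] forces the other
   piece of the same side, and of the same class, to be at least [m]. Hence [X] in [V i] against [Y]
   in [V j], or [X] in [V j] against [Y] in [V i], are both large. *)
case: (leqP m #|X :&: V i|) => h1.
  case: (leqP m #|Y :&: V j|) => h2; first exact: c1.
  by apply: c2; lia.
by apply: c2; lia.
Qed.

End Deterministic.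

(** * Exponential moments in G(n, p) *)

Section RandomGraph.
Variables (R : realType) (n : nat) (p : R).
Hypothesis p01 : 0 <= p <= 1.
Local Notation VP := (vertex_pairs 'I_n).
Implicit Types (E F : {set {set 'I_n}}) (P Q : {set {set 'I_n}} -> bool).

Definition gnp_weight E : R := \prod_(e in VP) (if e \in E then p else 1 - p).

Lemma gnp_weight_ge0 E : 0 <= gnp_weight E.
Proof.
by apply: prodr_ge0 => e _; case: ifP => _; have /andP[] := p01; rewrite ?subr_ge0.
Qed.

(** Expansion of the product. Extending [f] by 0 and [g] by 1 outside [D] kills the terms of sets
    not contained in [D]. *)
Lemma sum_subset_prod (I : finType) (D : {set I}) (f g : I -> R) :
  \sum_(E : {set I} | E \subset D) \prod_(e in D) (if e \in E then f e else g e) =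
  \prod_(e in D) (f e + g e).
Proof.
pose f' e := if e \in D then f e else 0; pose g' e := if e \in D then g e else 1.
have -> : \prod_(e in D) (f e + g e) = \prod_e (f' e + g' e).
  rewrite big_mkcond; apply: eq_bigr => e _; rewrite /f' /g'.
  by case: ifP; rewrite ?add0r.
rewrite bigA_distr big_mkcond; apply: eq_bigr => E _; case: ifPn => ED.
  rewrite big_mkcond; apply: eq_bigr => e _; rewrite /f' /g'.
  case: ifP => [//|eD]; case: ifP => // eE.
  by rewrite (fintype.subsetP ED) in eD.
have /subsetPn[e eE eD] := ED.
by rewrite (bigD1 e)//= eE /f' (negbTE eD) mul0r.
Qed.

(** By independence the generating function of the number of edges in [F] factorises, each pair of
    [F] contributing [p * t + (1 - p)]. *)
Lemma gnp_mgf F (t : R) : F \subset VP ->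
  \sum_(E : {set {set 'I_n}} | E \subset VP) gnp_weight E * t ^+ #|E :&: F| =
  (1 + p * (t - 1)) ^+ #|F|.
Proof.
move=> FV.
transitivity (\prod_(e in VP) (p * (if e \in F then t else 1) + (1 - p))).
  rewrite -sum_subset_prod; apply: eq_bigr => E EV.
  have -> : t ^+ #|E :&: F| = \prod_(e in VP) (if e \in E :&: F then t else 1).
    rewrite -big_mkcondr -prodr_const; apply: eq_bigl => e.
    rewrite finset.in_setI andbC; case: (boolP (e \in F)); rewrite ?andbF// => eF.
    by rewrite (fintype.subsetP FV).
  rewrite -big_split; apply: eq_bigr => e _; rewrite finset.in_setI.
  by case: (e \in E); case: (e \in F); rewrite /= ?mulr1.
transitivity (\prod_(e in VP) (if e \in F then 1 + p * (t - 1) else 1)).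
  by apply: eq_bigr => e _; case: (e \in F); ring.
rewrite -big_mkcondr -prodr_const; apply: eq_bigl => e.
by rewrite andbC; case: (boolP (e \in F)) => // eF; rewrite (fintype.subsetP FV).
Qed.

Lemma gnp_probE Q : gnp_prob p Q =
  \sum_(E : {set {set 'I_n}} | E \subset VP) gnp_weight E * (Q E)%:R.
Proof.
rewrite /gnp_prob big_mkcondr; apply: eq_bigr => E _.
by case: (Q E); rewrite ?mulr1 ?mulr0.
Qed.

Lemma gnp_prob_le Q (f : {set {set 'I_n}} -> R) :
  (forall E, E \subset VP -> (Q E)%:R <= f E) ->
  gnp_prob p Q <= \sum_(E : {set {set 'I_n}} | E \subset VP) gnp_weight E * f E.
Proof.
move=> Qf; rewrite gnp_probE; apply: ler_sum => E EV.
by rewrite ler_wpM2l ?gnp_weight_ge0 ?Qf.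
Qed.

Lemma gnp_prob_setC Q : gnp_prob p Q = 1 - gnp_prob p (fun E => ~~ Q E).
Proof.
(* The case of empty [F] says that the weights sum to 1. *)
have := gnp_mgf 1 (finset.sub0set VP); rewrite cards0 expr0 => <-.
rewrite !gnp_probE -sumrB; apply: eq_bigr => E _; rewrite expr1n.
by case: (Q E) => /=; ring.
Qed.

Lemma gnp_union_bound (I : finType) (S : {set I}) Q (P : I -> {set {set 'I_n}} -> bool) :
  (forall E, E \subset VP -> Q E -> exists2 i, i \in S & P i E) ->
  gnp_prob p Q <= \sum_(i in S) gnp_prob p (P i).
Proof.
move=> QP; under [leRHS]eq_bigr do rewrite gnp_probE.
rewrite exchange_big/=; under [leRHS]eq_bigr do rewrite -mulr_sumr.
apply: gnp_prob_le => E EV; case: (boolP (Q E)) => [/(QP _ EV)[i iS Pi]|_].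
  by rewrite (bigD1 i)//= Pi lerDl sumr_ge0.
by rewrite sumr_ge0.
Qed.

(** Markov's inequality for [t ^+ #|E :&: F|], followed by [1 + x <= e^x] in the generating
    function. *)
Lemma gnp_chernoff_ge F Q (t r : R) (t_ge1 : 1 <= t) : F \subset VP ->
  (forall E, E \subset VP -> Q E -> r <= #|E :&: F|%:R) ->
  gnp_prob p Q <= expR (p * (t - 1) * #|F|%:R - r * ln t).
Proof.
move=> FV Qr; have t0 : 0 < t by apply: lt_le_trans t_ge1.
apply: (@le_trans _ _ (\sum_(E : {set {set 'I_n}} | E \subset VP)
     gnp_weight E * (expR (- (r * ln t)) * t ^+ #|E :&: F|))).
  apply: gnp_prob_le => E EV; case: (boolP (Q E)) => [/(Qr _ EV) h|_].
    rewrite -[t in t ^+ _](lnK t0) -expRM_natl -expRD -[leLHS]expR0 ler_expR.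
    by rewrite addrC -mulrBl mulr_ge0 ?subr_ge0 ?ln_ge0.
  by rewrite mulr_ge0 ?expR_ge0 ?exprn_ge0// ltW.
under eq_bigr do rewrite mulrCA.
rewrite -mulr_sumr gnp_mgf// addrC expRD mulrC ler_wpM2r ?expR_ge0//.
rewrite expRM_natr lerXn2r// ?nnegrE ?expR_ge0 ?expR_ge1Dx//.
  by rewrite addr_ge0// mulr_ge0// ?subr_ge0//; case/andP: p01.
by rewrite addrC expR_ge1Dx.
Qed.

Lemma gnp_chernoff_le F Q (t r : R) (t01 : 0 < t <= 1) : F \subset VP ->
  (forall E, E \subset VP -> Q E -> #|E :&: F|%:R <= r) ->
  gnp_prob p Q <= expR (p * (t - 1) * #|F|%:R - r * ln t).
Proof.
move=> FV Qr; have /andP[t0 t1] := t01; have /andP[p0 p1] := p01.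
apply: (@le_trans _ _ (\sum_(E : {set {set 'I_n}} | E \subset VP)
     gnp_weight E * (expR (- (r * ln t)) * t ^+ #|E :&: F|))).
  apply: gnp_prob_le => E EV; case: (boolP (Q E)) => [/(Qr _ EV) h|_].
    rewrite -[t in t ^+ _](lnK t0) -expRM_natl -expRD -[leLHS]expR0 ler_expR.
    by rewrite addrC -mulrBl mulr_le0 ?subr_le0 ?ln_le0.
  by rewrite mulr_ge0 ?expR_ge0 ?exprn_ge0// ltW.
under eq_bigr do rewrite mulrCA.
rewrite -mulr_sumr gnp_mgf// addrC expRD mulrC ler_wpM2r ?expR_ge0//.
rewrite expRM_natr lerXn2r// ?nnegrE ?expR_ge0 ?expR_ge1Dx//.
  have := mulr_ge0 p0 (ltW t0); lra.
by rewrite addrC expR_ge1Dx.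
Qed.

(** The generating function at [t = 0]: since [0 ^+ 0 = 1], the power is exactly the indicator that
    [F] contains no edge. *)
Lemma gnp_no_edge F Q : F \subset VP ->
  (forall E, E \subset VP -> Q E -> [disjoint E & F]) ->
  gnp_prob p Q <= expR (- p * #|F|%:R).
Proof.
move=> FV Qr; have /andP[p0 p1] := p01.
apply: (@le_trans _ _ (\sum_(E : {set {set 'I_n}} | E \subset VP)
     gnp_weight E * 0 ^+ #|E :&: F|)).
  apply: gnp_prob_le => E EV; case: (boolP (Q E)) => [/(Qr _ EV) h|_].
    by rewrite disjoint_setI0// cards0 expr0.
  by rewrite exprn_ge0.
rewrite gnp_mgf// expRM_natr lerXn2r// ?nnegrE ?expR_ge0//; last first.
  by rewrite sub0r mulrN1 expR_ge1Dx.
by rewrite sub0r mulrN1 subr_ge0.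
Qed.

End RandomGraph.

(** * Degrees and edge counts as intersections with fixed sets of pairs *)

Section Edges.
Variable T : finType.
Implicit Types (E : {set {set T}}) (A B U : {set T}) (v : T).
Local Notation VP := (vertex_pairs T).

Definition star v : {set {set T}} := [set e in VP | v \in e].
Definition pairs_in U : {set {set T}} := [set e in VP | e \subset U].
Definition pairs_across A B : {set {set T}} := [set [set u.1; u.2] | u in finset.setX A B].

Lemma adj_neq E x y : E \subset VP -> adj E x y -> x != y.
Proof.
move=> EV /(fintype.subsetP EV); rewrite inE cards2.
by case: (x != y).
Qed.

Lemma set2_inj E v : E \subset VP -> {in nbrs E v &, injective (fun u => [set v; u])}.
Proof.
move=> EV y z; rewrite !inE => /(adj_neq EV) vy _ /setP /(_ y).
by rewrite !inE eqxx orbT eq_sym (negbTE vy) /= => /esym/eqP.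
Qed.

Lemma card_nbrs E v : E \subset VP -> #|nbrs E v| = #|E :&: star v|.
Proof.
move=> EV; rewrite -(card_in_imset (set2_inj (v := v) EV)); congr #|pred_of_set _|.
apply/setP => e; apply/imsetP/idP => [[u]|].
  rewrite inE /adj => vu ->; have := fintype.subsetP EV _ vu.
  by rewrite !inE => ->; rewrite eqxx vu.
rewrite !inE => /and3P[eE /cards2P[x [y [xy exy]]] ve].
move: ve; rewrite exy !inE => /orP[]/eqP ->.
  by exists y; rewrite ?inE /adj -?exy.
by exists x; rewrite ?inE /adj finset.setUC -?exy.
Qed.

Lemma star_sub v : star v \subset VP.
Proof. by apply/fintype.subsetP => e; rewrite inE => /andP[]. Qed.

Lemma pairs_in_sub U : pairs_in U \subset VP.
Proof. by apply/fintype.subsetP => e; rewrite inE => /andP[]. Qed.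

Lemma card_star v : #|star v| = #|T|.-1.
Proof.
rewrite -(finset.setIidPr (star_sub v)) -card_nbrs// -(cardsC1 v).
apply: eq_card => u; rewrite !inE /adj inE cards2 (eq_sym u v).
by case: (v == u).
Qed.

Lemma card_pairs_in U : #|pairs_in U| = 'C(#|U|, 2).
Proof.
by rewrite -cards_draws; apply: eq_card => e; rewrite !inE andbC.
Qed.

(** Double counting: an edge inside [U] is counted at most once from each of its two ends. *)
Lemma sum_deg_le E U : E \subset VP ->
  (\sum_(x in U) #|nbrs E x :&: U| <= #|E :&: pairs_in U|.*2)%N.
Proof.
move=> EV; set F := E :&: pairs_in U.
apply: (@leq_trans (\sum_(x in U) \sum_(e in F) (x \in e))%N).
  apply: leq_sum => x xU.
  have inj : {in nbrs E x :&: U &, injective (fun u => [set x; u])}.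
    by move=> y z /setIP[yE _] /setIP[zE _]; apply: set2_inj EV _ _ yE zE.
  rewrite -(card_in_imset inj) -big_mkcondr sum1_card.
  apply/subset_leq_card/fintype.subsetP => _ /imsetP[u /setIP[xu uU] ->].
  rewrite inE /adj in xu.
  rewrite unfold_in finset.set21 andbT /F /pairs_in finset.in_setI finset.in_set xu.
  rewrite (fintype.subsetP EV _ xu) /=.
  by apply/fintype.subsetP => y; rewrite !inE => /orP[]/eqP ->.
rewrite exchange_big /= -muln2 -sum_nat_const; apply: leq_sum => e.
rewrite !inE => /and3P[_ /eqP <- _].
by rewrite -big_mkcondr sum1_card; apply/subset_leq_card/fintype.subsetP => x /andP[].
Qed.

Lemma pairs_across_sub A B : [disjoint A & B] -> pairs_across A B \subset VP.
Proof.
move=> AB; apply/fintype.subsetP => _ /imsetP[[a b] /setXP[/= aA bB] ->].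
rewrite inE cards2; case: (eqVneq a b) => //= ab.
by move/disjoint_setI0/setP/(_ a): AB; rewrite !inE aA ab bB.
Qed.

Lemma card_pairs_across A B : [disjoint A & B] -> #|pairs_across A B| = (#|A| * #|B|)%N.
Proof.
move=> AB; rewrite -cardsX card_in_imset//.
have nAB x : x \in A -> x \in B -> False.
  by move=> xA xB; move/disjoint_setI0/setP/(_ x): AB; rewrite !inE xA xB.
move=> [a b] [a' b'] /setXP[/= aA bB] /setXP[/= aA' bB'] /setP e.
have -> : a = a'.
  have := e a; rewrite !inE eqxx /= => /esym/orP[/eqP//|/eqP ab].
  by case: (nAB a) => //; rewrite ab.
congr pair; have := e b; rewrite !inE eqxx orbT => /esym/orP[/eqP ba|/eqP//].
by case: (nAB b) => //; rewrite ba.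
Qed.

End Edges.

(** * An exponential bound on binomial coefficients *)

Section Binomial.
Variable R : realType.

Lemma ffact_le_exp n m : (n ^_ m <= n ^ m)%N.
Proof.
elim: m n => [|m IH] n; first by rewrite ffactn0.
by rewrite ffactnSr expnSr leq_mul// leq_subr.
Qed.

(** The right-hand side is [(e * n / u)^u]. It follows from ['C(n, u) * u! <= n^u] and from
    [u^u <= e^u * u!], a single term of the exponential series. *)
Lemma bin_le_exp (n u : nat) : (0 < u)%N -> (0 < n)%N ->
  'C(n, u)%:R <= expR (u%:R * (1 + ln (n%:R / u%:R))) :> R.
Proof.
case: u => // u _ n0.
have u0 : 0 < u.+1%:R :> R by rewrite ltr0n.
have n0' : 0 < n%:R :> R by rewrite ltr0n.
rewrite expRM_natl expRD lnK ?posrE ?divr_gt0// exprMn expr_div_n.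
have h1 : u.+1%:R ^+ u.+1 <= expR 1 ^+ u.+1 * u.+1`!%:R :> R.
  rewrite -ler_pdivrMr ?ltr0n ?fact_gt0// -expRM_natr mul1r.
  by have := expR_ge1Dxn u (ltW u0); lra.
have h2 : 'C(n, u.+1)%:R * u.+1`!%:R <= n%:R ^+ u.+1 :> R.
  by rewrite -natrM bin_ffact -natrX ler_nat ffact_le_exp.
rewrite mulrA ler_pdivlMr ?exprn_gt0//.
apply: (le_trans (ler_wpM2l (ler0n _ _) h1)).
by rewrite mulrCA ler_wpM2l ?exprn_ge0 ?expR_ge0.
Qed.

End Binomial.

(** * Low-probability events *)

Section BadEvents.
Variables (R : realType) (n : nat) (p : R).
Hypothesis p01 : 0 <= p <= 1.
Implicit Types (E : {set {set 'I_n}}) (A B U : {set 'I_n}).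

Lemma sum_le_card (I : finType) (S : {set I}) (F : I -> R) (b : R) :
  (forall i, i \in S -> F i <= b) -> \sum_(i in S) F i <= #|S|%:R * b.
Proof. by move=> Fb; rewrite mulr_natl -[b *+ _]sumr_const; exact: ler_sum. Qed.

Lemma gnp_low_degree (t a : R) : 0 < t <= 1 ->
  gnp_prob p (fun E => [exists v, #|nbrs E v|%:R < a]) <=
  n%:R * expR (p * (t - 1) * n.-1%:R - a * ln t).
Proof.
move=> t01; apply: (@le_trans _ _ (\sum_(v in [set: 'I_n])
    gnp_prob p (fun E => #|nbrs E v|%:R < a))).
  by apply: gnp_union_bound => // E _ /existsP[v va]; exists v.
rewrite -[n in n%:R]card_ord -cardsT; apply: sum_le_card => v _.
rewrite -[n in n.-1]card_ord -(card_star v).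
apply: gnp_chernoff_le => //; first exact: star_sub.
by move=> E EV /ltW; rewrite card_nbrs.
Qed.

Lemma gnp_high_degree (t b : R) : 1 <= t ->
  gnp_prob p (fun E => [exists v, b < #|nbrs E v|%:R]) <=
  n%:R * expR (p * (t - 1) * n.-1%:R - b * ln t).
Proof.
move=> t1; apply: (@le_trans _ _ (\sum_(v in [set: 'I_n])
    gnp_prob p (fun E => b < #|nbrs E v|%:R))).
  by apply: gnp_union_bound => // E _ /existsP[v va]; exists v.
rewrite -[n in n%:R]card_ord -cardsT; apply: sum_le_card => v _.
rewrite -[n in n.-1]card_ord -(card_star v).
apply: gnp_chernoff_ge => //; first exact: star_sub.
by move=> E EV /ltW; rewrite card_nbrs.
Qed.

Lemma gnp_no_cross_edge (m : nat) :
  gnp_prob p (fun E => [exists A : {set 'I_n}, exists B : {set 'I_n},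
     [&& [disjoint A & B], #|A| == m, #|B| == m & [disjoint E & pairs_across A B]]]) <=
  'C(n, m)%:R ^+ 2 * expR (- p * (m * m)%:R).
Proof.
pose D := [set A : {set 'I_n} | #|A| == m].
pose S := [set u in finset.setX D D | [disjoint u.1 & u.2]].
have cD : #|D| = 'C(n, m).
  rewrite -[in RHS](card_ord n) -cardsT -cards_draws; apply: eq_card => A.
  by rewrite !inE finset.subsetT.
apply: (@le_trans _ _ (\sum_(u in S)
    gnp_prob p (fun E => [disjoint E & pairs_across u.1 u.2]))).
  apply: gnp_union_bound => // E _ /existsP[A /existsP[B /and4P[AB Am Bm nE]]].
  by exists (A, B); rewrite ?inE ?Am ?Bm.
apply: (@le_trans _ _ (#|S|%:R * expR (- p * (m * m)%:R))).
  apply: sum_le_card => -[A B]; rewrite !inE /= => /andP[/andP[/eqP Am /eqP Bm] AB].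
  rewrite -[m in (m * _)%N]Am -[m in (_ * m)%N]Bm -card_pairs_across//.
  by apply: gnp_no_edge => //; exact: pairs_across_sub.
rewrite ler_wpM2r ?expR_ge0// -natrX ler_nat -cD -mulnn -cardsX.
by apply/subset_leq_card/fintype.subsetP => u; rewrite inE => /andP[].
Qed.

(** Minimum degree [2h] inside a set of size [u] forces at least [h * u] edges among its ['C(u, 2)]
    pairs; Chernoff and a union bound over the sets finish. *)
Lemma gnp_dense_subset (h u : nat) (t : R) : 1 <= t ->
  gnp_prob p (fun E => [exists U : {set 'I_n}, (#|U| == u) &&
     [forall x in U, h.*2 <= #|nbrs E x :&: U|]%N]) <=
  'C(n, u)%:R * expR (p * (t - 1) * 'C(u, 2)%:R - (h * u)%:R * ln t).
Proof.
move=> t1; pose S := [set U : {set 'I_n} | #|U| == u].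
apply: (@le_trans _ _ (\sum_(U in S)
    gnp_prob p (fun E => [forall x in U, h.*2 <= #|nbrs E x :&: U|]%N))).
  by apply: gnp_union_bound => // E _ /existsP[U /andP[Uu hU]]; exists U; rewrite ?inE.
have -> : 'C(n, u) = #|S|.
  rewrite -[in LHS](card_ord n) -cardsT -cards_draws; apply: eq_card => A.
  by rewrite !inE finset.subsetT.
apply: sum_le_card => U; rewrite inE => /eqP <-; rewrite -card_pairs_in.
apply: gnp_chernoff_ge => //; first exact: pairs_in_sub.
move=> E EV /forall_inP hU; rewrite ler_nat -leq_double.
apply: leq_trans (sum_deg_le _ EV); rewrite doubleMl mulnC -sum_nat_const.
exact: leq_sum.
Qed.

(** Sets of size [u] contribute at most [z ^+ u], and [z <= 1/2] bounds the geometric series by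
    [2 * z]. The condition on [p * u] says that [2h] is at least [e^3] times the average degree
    expected in a set of size [u]. *)
Lemma gnp_dense_subsets (h M : nat) (z : R) : (2 <= h)%N -> (0 < n)%N -> 0 < p ->
  (forall u, (u < M)%N -> p * u%:R * expR 3 <= h.*2%:R) ->
  n%:R * p * expR (4 - h.*2%:R) <= z -> z <= 2^-1 ->
  gnp_prob p (fun E => [exists U : {set 'I_n}, [&& U != finset.set0, (#|U| < M)%N &
     [forall x in U, h.*2 <= #|nbrs E x :&: U|]%N]]) <= 2 * z.
Proof.
move=> h2 n0 p0 small zlb z2; pose S := [set u : 'I_M | (0 < u)%N].
have n0' : 0 < n%:R :> R by rewrite ltr0n.
have z0 : 0 <= z by apply: le_trans zlb; rewrite !mulr_ge0 ?expR_ge0// ltW.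
apply: (@le_trans _ _ (\sum_(u in S)
    gnp_prob p (fun E => [exists U : {set 'I_n}, (#|U| == u) &&
     [forall x in U, h.*2 <= #|nbrs E x :&: U|]%N]))).
  apply: gnp_union_bound => // E _ /existsP[U /and3P[U0 UM hU]].
  exists (Ordinal UM); first by rewrite inE /= card_gt0.
  by apply/existsP; exists U; rewrite eqxx.
apply: (@le_trans _ _ (\sum_(u in S) z ^+ u)); last first.
  (* The subtracted power makes the induction close; [maxn] covers [N = 0], where the sum is as
     empty as for [N = 1]. *)
  suff sumz : forall N, \sum_(u < N | (0 < u)%N) z ^+ u <= 2 * z - 2 * z ^+ (maxn 1 N).
    have := sumz M; rewrite (eq_bigl (fun u => u \in S)); last by move=> u; rewrite inE.
    move=> /le_trans; apply; rewrite gerBl mulr_ge0 ?exprn_ge0//.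
  elim=> [|N IH]; first by rewrite big_ord0 maxn0 expr1 subrr.
  rewrite big_mkcond big_ord_recr -big_mkcond /=.
  case: N IH => [|N IH] /=; first by rewrite big_ord0 addr0 maxnn expr1 subrr.
  rewrite !(maxn_idPr _)//= in IH *; rewrite [z ^+ N.+2]exprS.
  have : z * z ^+ N.+1 <= 2^-1 * z ^+ N.+1 by rewrite ler_wpM2r ?exprn_ge0.
  lra.
apply: ler_sum => u; rewrite inE => u0.
have u0' : 0 < (u : nat)%:R :> R by rewrite ltr0n.
have h0 : 0 < h.*2%:R :> R by rewrite ltr0n double_gt0 (leq_trans _ h2).
have pu0 : 0 < p * (u : nat)%:R by rewrite mulr_gt0.
(* With this [t], [p * t * u^2 / 2 = h * u], so the first term of the Chernoff exponent is at most
   [h * u], while [ln t >= 3]. *)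
pose t := h.*2%:R / (p * (u : nat)%:R).
have e3 : expR 3 <= t by rewrite ler_pdivlMr// mulrC; apply: small.
have lnt : 3 <= ln t by rewrite -[leLHS](expRK) ler_ln// posrE ?expR_gt0// divr_gt0.
have t1 : 1 <= t by apply: le_trans e3; rewrite -[leLHS]expR0 ler_expR.
apply: le_trans (gnp_dense_subset h u t1) _.
apply: le_trans (ler_wpM2r (expR_ge0 _) (bin_le_exp R u0 n0)) _.
rewrite -expRD.
have hpos : 1 <= h.*2%:R :> R by rewrite ler1n double_gt0 (leq_trans _ h2).
have zE : expR (ln (n%:R * p) + (4 - h.*2%:R)) ^+ u <= z ^+ u.
  rewrite lerXn2r ?nnegrE ?expR_ge0//.
  by rewrite expRD lnK// posrE mulr_gt0.
apply: le_trans zE; rewrite -expRM_natl ler_expR natrM.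
have bin2 : 'C(u, 2)%:R <= (u : nat)%:R * (u : nat)%:R / 2 :> R.
  rewrite ler_pdivlMr// -natrM -natrM ler_nat bin2 muln2.
  have := leq_trunc_div ((nat_of_ord u) * (nat_of_ord u).-1) 2.
  rewrite divn2 muln2 => /leq_trans; apply; rewrite leq_mul2l leq_pred orbT//.
have lnX : ln (n%:R * p) = ln (n%:R / (u : nat)%:R) - ln t + ln (h.*2%:R : R).
  rewrite -ln_div ?posrE ?divr_gt0// -lnM ?posrE ?divr_gt0// ?(lt_le_trans _ t1)//.
  by congr ln; rewrite /t; field; rewrite ?gt_eqF.
have edges : p * (t - 1) * 'C(u, 2)%:R <= h%:R * (u : nat)%:R.
  apply: (@le_trans _ _ (p * t * ((u : nat)%:R * (u : nat)%:R / 2))).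
    have pt : p * (t - 1) <= p * t by rewrite ler_wpM2l ?(ltW p0)// gerBl.
    apply: (@le_trans _ _ (p * t * 'C(u, 2)%:R)); first by rewrite ler_wpM2r.
    by rewrite ler_wpM2l// mulr_ge0 ?(ltW p0)// (le_trans _ t1).
  rewrite /t -muln2 natrM le_eqVlt; apply/orP; left; apply/eqP; field.
  by rewrite !gt_eqF.
have lnh : 0 <= ln (h.*2%:R : R) by rewrite ln_ge0.
have h1 : 3 * (h%:R - 1) <= ln t * (h%:R - 1).
  by rewrite ler_wpM2r// subr_ge0 ler1n (leq_trans _ h2).
(* The exponent divided by [u]. As [n / u = n * p * t / (2h)], the entropy term costs one [ln t],
   and the remaining [(h - 1) * ln t >= 3 * (h - 1)] gives [4 - 2h]. *)
have key : 1 + ln (n%:R / (u : nat)%:R) + h%:R - h%:R * ln t <=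
    ln (n%:R * p) + (4 - h.*2%:R).
  by rewrite lnX -muln2 natrM in lnh *; lra.
have := ler_wpM2l (ltW u0') key; lra.
Qed.

End BadEvents.

(** * From pseudorandomness to a rigid partition, and union bounds *)

Lemma exists_subset_card (T : finType) (A : {set T}) (m : nat) :
  (m <= #|A|)%N -> exists2 B : {set T}, B \subset A & #|B| = m.
Proof.
rewrite -bin_gt0 -cards_draws => /card_gt0P[B]; rewrite inE => /andP[BA /eqP Bm].
by exists B.
Qed.

Lemma rigid_of_pseudorandom (R : realType) (T : finType) (E : {set {set T}})
    (d k m : nat) (a Delta : R) :
  (0 < #|T|)%N -> (0 < d)%N -> (0 < k)%N -> 1 <= Delta ->
  4 * (d%:R * expR (k%:R - a / (2 * d%:R))) * Delta ^+ 2 <= 1 ->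
  (forall v, a <= #|nbrs E v|%:R <= Delta) ->
  ~~ [exists U : {set T}, [&& U != finset.set0, (#|U| < m.*2)%N &
       [forall x in U, k <= #|nbrs E x :&: U|]%N]] ->
  ~~ [exists A : {set T}, exists B : {set T},
       [&& [disjoint A & B], #|A| == m, #|B| == m & [disjoint E & pairs_across A B]]] ->
  has_strong_rigid_partition d E.
Proof.
move=> T0 d0 k0 D1 small degE /existsPn dense /existsPn cross.
have Nsym u v : (u \in nbrs E v) = (v \in nbrs E u) by rewrite !inE adjC.
have [f fk] := exists_colouring d0 D1 Nsym degE small.
apply: (strong_rigid_of_colouring (k := k) (m := m) T0 k0 fk) => [U U0 Um|A B AB mA mB].
  have := dense U; rewrite U0 Um /= => /forall_inPn[x xU]; rewrite -ltnNge => h.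
  by exists x.
(* The excluded event concerns sets of size exactly [m], so larger sets are shrunk first. *)
have [A' A'A cA] := exists_subset_card mA; have [B' B'B cB] := exists_subset_card mB.
have AB' : [disjoint A' & B'] by apply: disjointWl A'A (disjointWr B'B AB).
have /existsPn/(_ B') := cross A'; rewrite AB' cA cB !eqxx /= -finset.setI_eq0.
move=> /finset.set0Pn[e /setIP[eE /imsetP[[x y] /setXP[/= xA yB] exy]]].
by exists x, y; rewrite (fintype.subsetP A'A)// (fintype.subsetP B'B)// /adj -exy.
Qed.

Lemma gnp_prob_or (R : realType) (n : nat) (p : R) (p01 : 0 <= p <= 1)
    (Q P P' : {set {set 'I_n}} -> bool) :
  (forall E : {set {set 'I_n}}, E \subset vertex_pairs 'I_n -> Q E -> P E || P' E) ->
  gnp_prob p Q <= gnp_prob p P + gnp_prob p P'.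
Proof.
move=> h.
apply: (@le_trans _ _ (\sum_(b in [set: bool]) gnp_prob p (if b then P else P'))).
  apply: gnp_union_bound => // E EV QE.
  by case/orP: (h E EV QE) => PE; [exists true|exists false].
by rewrite (eq_bigl xpredT) ?big_bool// => b; rewrite inE.
Qed.

Lemma gnp_prob_or4 (R : realType) (n : nat) (p : R) (p01 : 0 <= p <= 1)
    (Q P1 P2 P3 P4 : {set {set 'I_n}} -> bool) :
  (forall E : {set {set 'I_n}}, E \subset vertex_pairs 'I_n -> Q E ->
     [|| P1 E, P2 E, P3 E | P4 E]) ->
  gnp_prob p Q <= gnp_prob p P1 + (gnp_prob p P2 + (gnp_prob p P3 + gnp_prob p P4)).
Proof.
move=> h; apply: le_trans (gnp_prob_or p01 h) _; rewrite lerD2l.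
apply: le_trans (@gnp_prob_or _ _ _ p01 _ P2 (fun E => P3 E || P4 E) _) _ => //.
by rewrite lerD2l; apply: gnp_prob_or.
Qed.

Lemma expRN_le_inv (R : realType) (x : R) : 0 < x -> expR (- x) <= x^-1.
Proof.
move=> x0; rewrite expRN lef_pV2 ?posrE ?expR_gt0//.
by apply: le_trans (expR_ge1Dx x); rewrite lerDr.
Qed.

(** * Choice of parameters and the failure probability *)

Section Bounds.
Variables (R : realType) (n : nat) (p eta : R).
Hypotheses (p01 : 0 <= p <= 1) (eta01 : 0 < eta <= 1).
Local Notation l := (ln (n%:R : R)).
Local Notation X := (n%:R * p).
Local Notation L := (ln X).
Hypothesis l_ge1 : 1 <= l.
Hypothesis X_ge : (1 + eta) * l <= X.

Local Lemma n_gt0 : (0 < n)%N.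
Proof.
(* [ln 0] is 0 by convention, so [1 <= l] excludes [n = 0]. *)
by rewrite lt0n; apply/eqP => n0; move: l_ge1; rewrite n0 ln0// ler10.
Qed.

Local Lemma X_ge_l : l <= X.
Proof.
apply: le_trans X_ge; rewrite ler_peMl ?(le_trans ler01 l_ge1)//.
by have /andP[e0 _] := eta01; lra.
Qed.

Local Lemma p_gt0 : 0 < p.
Proof.
have X0 : 0 < X by apply: lt_le_trans X_ge_l; apply: lt_le_trans l_ge1.
by move: X0; rewrite pmulr_rgt0// ltr0n n_gt0.
Qed.

Local Lemma pn1E : p * n.-1%:R = X - p.
Proof. by rewrite -subn1 natrB ?n_gt0//; ring. Qed.

(** Chernoff with [t = eta / 8] and threshold [t^2 * X]. Since [- t * ln t <= 1], the exponent is at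
    most [l - (1 - 2 * t) * X + 1], and [X >= (1 + eta) * l] with [eta <= 1] makes this at most
    [1 - eta * l / 2]. *)
Lemma low_degree_le :
  gnp_prob p (fun E : {set {set 'I_n}} => [exists v, #|nbrs E v|%:R < (eta / 8) ^+ 2 * X])
  <= 2 * expR 1 / (eta * l).
Proof.
have /andP[e0 e1] := eta01; have /andP[p0 p1] := p01.
have l0 : 0 < l by apply: lt_le_trans l_ge1.
set t := eta / 8; have t0 : 0 < t by rewrite divr_gt0.
have t1 : t <= 8^-1 by rewrite /t; lra.
have t01 : 0 < t <= 1 by rewrite t0 (le_trans t1)// invf_le1//; lra.
apply: (le_trans (gnp_low_degree n p01 (t ^+ 2 * X) t01)).
have lnt : - (t * ln t) <= 1.
  have := le_ln1Dx (x := t^-1 - 1); rewrite [1 + _]addrC subrK lnV ?posrE//.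
  have ti : 0 < t^-1 by rewrite invr_gt0.
  have h0 : -1 < t^-1 - 1 by lra.
  move=> /(_ h0) h; have := ler_wpM2l (ltW t0) h.
  by rewrite mulrBr mulfV ?gt_eqF//; lra.
have X0 : 0 <= X by rewrite mulr_ge0.
have {1}-> : n%:R = expR l by rewrite lnK// posrE ltr0n n_gt0.
rewrite -expRD.
apply: (@le_trans _ _ (expR (1 + - (eta / 2 * l)))).
  rewrite ler_expR mulrAC pn1E.
  have h1 := ler_wpM2l (mulr_ge0 X0 (ltW t0)) lnt.
  have h2 : (1 - eta / 4) * ((1 + eta) * l) <= (1 - eta / 4) * X.
    by rewrite ler_wpM2l//; lra.
  have h3 : 0 <= eta * (1 - eta) * l by rewrite !mulr_ge0 ?subr_ge0// ltW.
  have pt : (1 - t) * p <= 1 by rewrite mulr_ile1//; lra.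
  have tE : eta = 8 * t by rewrite /t; field.
  move: h2 h3; rewrite tE => h2 h3.
  nra.
have -> : 2 * expR 1 / (eta * l) = expR 1 * (eta / 2 * l)^-1.
  by field; rewrite !gt_eqF.
by rewrite expRD ler_wpM2l ?expR_ge0// expRN_le_inv// mulr_gt0// divr_gt0.
Qed.

(** Chernoff with [t = 2]: as [ln 2 >= 1/2], the exponent is at most [l + X - 3 * X <= - l]. *)
Lemma high_degree_le :
  gnp_prob p (fun E : {set {set 'I_n}} => [exists v, 6 * X < #|nbrs E v|%:R]) <= l^-1.
Proof.
have /andP[p0 p1] := p01.
have l0 : 0 < l by apply: lt_le_trans l_ge1.
have t1 : 1 <= 2 :> R by lra.
apply: le_trans (gnp_high_degree n p01 (6 * X) t1) _ => //.
have ln2 : 2^-1 <= ln 2 :> R.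
  have h : -1 < - (2^-1) :> R by lra.
  have := le_ln1Dx h; have -> : 1 - 2^-1 = 2^-1 :> R by field.
  by rewrite lnV ?posrE//; lra.
have X0 : 0 <= X by rewrite mulr_ge0.
apply: le_trans (expRN_le_inv l0).
have {1}-> : n%:R = expR l by rewrite lnK// posrE ltr0n n_gt0.
rewrite -expRD ler_expR mulrAC pn1E.
have := ler_wpM2l X0 ln2; have := X_ge_l; lra.
Qed.

Hypothesis L_ge1 : 1 <= L.
(** The successor rounds up. The constants fit together: [u < 2m] gives [p * u <= 12 * L], hence
    [p * u * e^3 <= 2h]. *)
Local Notation h := (Num.truncn (6 * expR 3 * L)).+1.
Local Notation m := (Num.truncn (5 * L / p)).+1.

Local Lemma m_bounds : 5 * L <= p * m%:R <= 6 * L.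
Proof.
have p0 := p_gt0; have /andP[_ p1] := p01.
have r0 : 0 <= 5 * L / p by rewrite divr_ge0 ?(ltW p0)// mulr_ge0// (le_trans ler01 L_ge1).
have /andP[mlb mub] := truncn_itv r0.
apply/andP; split.
  by rewrite [p * _]mulrC -ler_pdivrMr// ltW.
rewrite -natr1 mulrDr mulr1.
have : p * (Num.truncn (5 * L / p))%:R <= 5 * L by rewrite [p * _]mulrC -ler_pdivlMr.
by have := L_ge1; lra.
Qed.

Local Lemma h_bounds : 6 * expR 3 * L <= h%:R <= (6 * expR 3 + 1) * L.
Proof.
have r0 : 0 <= 6 * expR 3 * L :> R by rewrite !mulr_ge0 ?expR_ge0// (le_trans ler01 L_ge1).
have /andP[hlb hub] := truncn_itv r0.
rewrite (ltW hub) /=; have := lerD hlb L_ge1; rewrite natr1 => /le_trans; apply.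
lra.
Qed.

Lemma no_cross_edge_le :
  gnp_prob p (fun E => [exists A : {set 'I_n}, exists B : {set 'I_n},
     [&& [disjoint A & B], #|A| == m, #|B| == m & [disjoint E & pairs_across A B]]])
  <= l^-1.
Proof.
apply: le_trans (gnp_no_cross_edge n p01 m) _.
have /andP[pm5 _] := m_bounds.
have n0 : 0 < n%:R :> R by rewrite ltr0n n_gt0.
have X0 : 0 < X by rewrite mulr_gt0// p_gt0.
have m0 : 0 < m%:R :> R by rewrite ltr0n.
have m1 : 1 <= m%:R :> R by rewrite ler1n.
have pm0 : 0 < p * m%:R by rewrite mulr_gt0// p_gt0.
apply: (@le_trans _ _ (expR (- L))); last first.
  rewrite expRN lnK ?posrE// lef_pV2 ?posrE ?X_ge_l//.
  by apply: lt_le_trans l_ge1.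
have b := bin_le_exp R (ltn0Sn _ : (0 < m)%N) n_gt0.
apply: (@le_trans _ _ (expR (m%:R * (1 + ln (n%:R / m%:R))) ^+ 2 * expR (- p * (m * m)%:R))).
  by rewrite ler_wpM2r ?expR_ge0// lerXn2r ?nnegrE ?expR_ge0.
rewrite -expRM_natl -expRD ler_expR natrM.
have lnE : ln (n%:R / m%:R) = L - ln (p * m%:R).
  rewrite -ln_div ?posrE//; congr ln; field.
  by rewrite !gt_eqF// p_gt0.
have pm1 : 0 <= ln (p * m%:R) by rewrite ln_ge0//; have := L_ge1; lra.
(* The exponent divided by [m]: as [n / m = X / (p * m)] and [p * m >= 5 * L], it is at most
   [2 + 2 * L - 5 * L]. *)
have key : 2 * (1 + ln (n%:R / m%:R)) - p * m%:R <= - L.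
  by rewrite lnE; have := L_ge1; lra.
have := ler_wpM2l (ltW m0) key.
have : L <= m%:R * L by rewrite ler_peMl// (le_trans ler01 L_ge1).
lra.
Qed.

Lemma dense_subsets_le :
  gnp_prob p (fun E => [exists U : {set 'I_n}, [&& U != finset.set0, (#|U| < m.*2)%N &
     [forall x in U, h.*2 <= #|nbrs E x :&: U|]%N]]) <= 2 / l.
Proof.
have l0 : 0 < l by apply: lt_le_trans l_ge1.
have n0 : 0 < n%:R :> R by rewrite ltr0n n_gt0.
have X0 : 0 < X by rewrite mulr_gt0// p_gt0.
have /andP[hl _] := h_bounds; have /andP[_ pm] := m_bounds.
have e3 : 1 <= expR 3 :> R by rewrite -[leLHS]expR0 ler_expR.
have eL : L <= expR 3 * L by rewrite ler_peMl// (le_trans ler01 L_ge1).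
have h6 : 6 * L <= h%:R by apply: le_trans hl; lra.
have h2 : (2 <= h)%N.
  by rewrite -(ler_nat R); apply: le_trans h6; have := L_ge1; lra.
(* The ratio is [z = e^-L = 1 / X]; [h >= 6 * L] leaves ample room for [L + 4 - 2h <= - L]. *)
apply: (@le_trans _ _ (2 * expR (- L))); last first.
  rewrite ler_wpM2l// expRN lnK ?posrE// lef_pV2 ?posrE ?X_ge_l//.
apply: gnp_dense_subsets => //; rewrite ?n_gt0 ?p_gt0//.
- move=> u um.
  have pu : p * u%:R <= p * (m%:R * 2).
    by rewrite ler_wpM2l ?(ltW p_gt0)// -natrM ler_nat muln2 ltnW.
  have := ler_wpM2r (expR_ge0 3) pu.
  have := ler_wpM2r (expR_ge0 3) pm.
  by rewrite -muln2 natrM; lra.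
- rewrite -{1}(lnK (x := X)) ?posrE// -expRD ler_expR -muln2 natrM.
  by have := L_ge1; lra.
- have h0 : 0 < L by apply: lt_le_trans L_ge1.
  rewrite expRN lef_pV2 ?posrE ?expR_gt0//.
  by apply: le_trans (expR_ge1Dx _); have := L_ge1; lra.
Qed.

(** Chosen so that [d <= rigid_const * X / L] gives [(eta / 8)^2 * X / (2d) >= (12 * e^3 + 6) * L],
    which exceeds [2h <= (12 * e^3 + 2) * L] by [4 * L]. *)
Definition rigid_const : R := (eta / 8) ^+ 2 / (4 * (6 * expR 3 + 3)).

Hypotheses (X_ge144 : 144 <= X) (L_le : L <= rigid_const * X).

Lemma gnp_not_rigid_le :
  gnp_prob p (fun E : {set {set 'I_n}} =>
    ~~ has_strong_rigid_partition (Num.truncn (rigid_const * X / L)) E)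
  <= (2 * expR 1 / eta + 4) / l.
Proof.
have /andP[e0 e1] := eta01.
have l0 : 0 < l by apply: lt_le_trans l_ge1.
have L0 : 0 < L by apply: lt_le_trans L_ge1.
have n0 : 0 < n%:R :> R by rewrite ltr0n n_gt0.
have X0 : 0 < X by rewrite mulr_gt0// p_gt0.
have -> : (2 * expR 1 / eta + 4) / l =
    2 * expR 1 / (eta * l) + (l^-1 + (2 / l + l^-1)).
  by field; rewrite !gt_eqF.
apply: le_trans (lerD low_degree_le (lerD high_degree_le
  (lerD dense_subsets_le no_cross_edge_le))).
set d := Num.truncn _.
apply: gnp_prob_or4 => // E _; apply: contraNT.
rewrite !negb_or => /and4P[/existsPn nP /existsPn nP' nP'' nP3].
have c0 : 0 < rigid_const.
  by rewrite divr_gt0 ?exprn_gt0 ?divr_gt0// mulr_gt0// addr_gt0// mulr_gt0 ?expR_gt0.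
(* Here [L_le] ensures that at least one colour is available. *)
have cX1 : 1 <= rigid_const * X / L by rewrite ler_pdivlMr// mul1r.
have /andP[dub _] := truncn_itv (le_trans ler01 cX1).
have d0 : (0 < d)%N by rewrite truncn_gt0.
have d0' : 0 < d%:R :> R by rewrite ltr0n.
have /andP[_ hub] := h_bounds.
apply: (rigid_of_pseudorandom (R := R) (k := h.*2) (m := m) (a := (eta / 8) ^+ 2 * X)
  (Delta := 6 * X)) => //.
- by rewrite card_ord n_gt0.
- by move: X_ge144; lra.
- have K0 : 0 < 6 * expR 3 :> R by rewrite mulr_gt0 ?expR_gt0.
  have aE : (eta / 8) ^+ 2 = rigid_const * (4 * (6 * expR 3 + 3)).
    by rewrite /rigid_const divfK// gt_eqF// mulr_gt0// addr_gt0.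
  have exponent : h.*2%:R - (eta / 8) ^+ 2 * X / (2 * d%:R) <= - (4 * L).
    have : 2 * (6 * expR 3 + 3) * L <= (eta / 8) ^+ 2 * X / (2 * d%:R).
      rewrite ler_pdivlMr ?mulr_gt0// aE.
      have : L * d%:R <= rigid_const * X by rewrite mulrC -ler_pdivlMr.
      move=> /(ler_wpM2l (_ : 0 <= 4 * (6 * expR 3 + 3))) hh.
      have /hh : 0 <= 4 * (6 * expR 3 + 3) :> R by lra.
      lra.
    by rewrite -muln2 natrM; lra.
  have dX : d%:R <= X.
    apply: le_trans dub _; rewrite ler_pdivrMr//.
    have c1 : rigid_const <= 1.
      rewrite ler_pdivrMr ?mulr_gt0 ?addr_gt0// mul1r.
      apply: (@le_trans _ _ 1); last by lra.
      by rewrite expr_le1//; lra.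
    apply: (@le_trans _ _ X); first by rewrite ler_piMl// ltW.
    by rewrite ler_peMr// ltW.
  have eX : expR (- (4 * L)) = X ^- 4 by rewrite expRN expRM_natl lnK.
  (* With [d <= X] and failure probability [X^-4] per class, the local lemma condition becomes
     [144 / X <= 1]; this is the origin of [X_ge144]. *)
  apply: (@le_trans _ _ (4 * (X * X ^- 4) * (6 * X) ^+ 2)).
    have dexp : d%:R * expR (h.*2%:R - (eta / 8) ^+ 2 * X / (2 * d%:R)) <= X * X ^- 4.
      by apply: ler_pM => //; rewrite ?expR_ge0// -eX ler_expR.
    apply: ler_wpM2r; first by rewrite exprn_ge0// mulr_ge0// ltW.
    exact: ler_wpM2l.
  have -> : 4 * (X * X ^- 4) * (6 * X) ^+ 2 = 144 / X.
    by field; rewrite !gt_eqF// p_gt0.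
  by rewrite ler_pdivrMr// mul1r.
- by move=> v; have := nP v; have := nP' v; rewrite -!leNgt => -> ->.
Qed.

End Bounds.

(** * Asymptotics in [n] and the limit *)

Lemma rigid_const_gt0 (R : realType) (eta : R) : 0 < eta -> 0 < rigid_const eta.
Proof.
by move=> e0; rewrite divr_gt0 ?exprn_gt0 ?divr_gt0// mulr_gt0// addr_gt0//.
Qed.

(** With [s] the square root of [x], [ln x = 2 * ln s <= 2 * s], and [2 <= c * s] by the lower bound
    on [x]. *)
Lemma ln_le_linear (R : realType) (c x : R) :
  0 < c -> 0 < x -> 4 / c ^+ 2 <= x -> ln x <= c * x.
Proof.
move=> c0 x0 cx; have s0 : 0 < Num.sqrt x by rewrite sqrtr_gt0.
have xE : x = Num.sqrt x ^+ 2 by rewrite sqr_sqrtr// ltW.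
have h : 2 <= c * Num.sqrt x.
  rewrite -(@ler_pXn2r _ 2)// ?nnegrE ?mulr_ge0 ?(ltW c0) ?(ltW s0)//.
  by move: cx; rewrite ler_pdivrMr ?exprn_gt0// exprMn -xE; lra.
rewrite xE lnXn// mulr2n.
have := ln_sublinear s0; have := ler_wpM2r (ltW s0) h; rewrite expr2; lra.
Qed.

Lemma near_ln_ge (R : realType) (C : R) :
  (\forall n \near \oo, C <= ln (n%:R : R))%classic.
Proof.
exists (Num.truncn (expR C)).+1 => // n /= hn.
have /andP[_ h] := truncn_itv (expR_ge0 C).
have hn' : expR C <= n%:R by apply: le_trans (ltW h) _; rewrite ler_nat.
by rewrite -[leLHS](expRK) ler_ln// posrE ?expR_gt0// (lt_le_trans _ hn') ?expR_gt0.
Qed.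

Local Open Scope classical_set_scope.
Local Open Scope ring_scope.

Theorem theorem1p10 (R : realType) (eps : R) (eps_gt0 : 0 < eps) :
  exists c : R, 0 < c /\
    forall p : nat -> R,
      (forall n : nat, 0 <= p n <= 1) ->
      (\forall n \near \oo, (1 + eps) * ln (n%:R : R) / n%:R <= p n) ->
      (fun n : nat =>
         gnp_prob (p n)
           (@has_strong_rigid_partition 'I_n
              (Num.truncn (c * (n%:R * p n) / ln (n%:R * p n)))))
        @ \oo --> (1 : R).
Proof.
(* The estimates require [eta <= 1]; lowering [eps] only weakens the assumption on [p]. *)
pose eta := Num.min eps 1.
have eta0 : 0 < eta by rewrite lt_min eps_gt0 ltr01.
have eta1 : eta <= 1 by rewrite ge_min lexx orbT.
have eta_eps : eta <= eps by rewrite ge_min lexx.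
pose c := rigid_const eta; have c0 : 0 < c by apply: rigid_const_gt0.
exists c; split => // p p01 p_ge.
apply/cvgrPdist_le => e e0.
pose M : R := 2 * expR 1 / eta + 4.
near=> n.
(* Since [n * p >= ln n], lower bounds on [ln n] carry over to [n * p]: 144 serves the local lemma,
   [4 / c ^+ 2] gives [ln (n * p) <= c * (n * p)], and [M / e] makes the failure probability at most
   [e]. *)
have l144 : 144 <= ln (n%:R : R) by near: n; exact: near_ln_ge.
have lc : 4 / c ^+ 2 <= ln (n%:R : R) by near: n; exact: near_ln_ge.
have lM : M / e <= ln (n%:R : R) by near: n; exact: near_ln_ge.
have pn : (1 + eps) * ln (n%:R : R) / n%:R <= p n by near: n.
have l1 : 1 <= ln (n%:R : R) by lra.
have n0 : 0 < n%:R :> R.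
  by rewrite ltr0n lt0n; apply/eqP => n0; move: l1; rewrite n0 ln0// ler10.
have X_ge : (1 + eta) * ln (n%:R : R) <= n%:R * p n.
  move: pn; rewrite ler_pdivrMr// [p n * _]mulrC; apply: le_trans.
  by rewrite ler_wpM2r; lra.
have lX : ln (n%:R : R) <= n%:R * p n.
  apply: le_trans X_ge; rewrite ler_peMl; lra.
have X0 : 0 < n%:R * p n by lra.
have L1 : 1 <= ln (n%:R * p n).
  rewrite -[leLHS]expRK ler_ln ?posrE ?expR_gt0//.
  (* [e <= 4] is enough: [e^(-1/2) >= 1/2] gives [e^(1/2) <= 2]. *)
  have -> : expR 1 = expR (2^-1) ^+ 2 :> R.
    by rewrite -expRM_natl divff// pnatr_eq0.
  have := expR_ge1Dx (- (2^-1) : R); rewrite expRN => h.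
  have h2 : expR (2^-1) <= 2 :> R.
    by rewrite -[leRHS]invrK -[leLHS]invrK lef_pV2 ?posrE ?invr_gt0 ?expR_gt0//; lra.
  apply: (@le_trans _ _ (2 ^+ 2)); last by lra.
  by rewrite lerXn2r ?nnegrE ?expR_ge0.
have bound := gnp_not_rigid_le (p01 n) (introT andP (conj eta0 eta1)) l1 X_ge L1
  (le_trans l144 lX) (ln_le_linear c0 X0 (le_trans lc lX)).
rewrite gnp_prob_setC// subKr ger0_norm.
  apply: le_trans bound _.
  by rewrite ler_pdivrMr ?(lt_le_trans ltr01 l1)// [e * _]mulrC -ler_pdivrMr.
by rewrite gnp_probE sumr_ge0// => E _; rewrite mulr_ge0// gnp_weight_ge0.
Unshelve. all: by end_near.
Qed.
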